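(* There does not exist a universal two-dimensional right-angled Artin group. That is, there is no finitely generated right-angled Artin group $G$ of cohomological dimension $2$ such that every finitely generated right-angled Artin group of cohomological dimension $2$ embeds into $G$.
   Context: For a simplicial graph $\Gamma$ (no loops, no multi-edges) with vertex set $V(\Gamma)$ and edge set $E(\Gamma)$, the right-angled Artin group is $A(\Gamma)=\langle V(\Gamma)\mid [v,v']=1 \text{ for each } \{v,v'\}\in E(\Gamma)\rangle$; it is finitely generated exactly when $\Gamma$ is finite. A right-angled Artin group is $n$-dimensional if its cohomological dimension is $n$. An $n$-dimensional finitely generated right-angled Artin group $G$ is a universal $n$-dimensional right-angled Artin group if $G$ contains (as a subgroup) an isomorphic copy of each finitely generated $n$-dimensional right-angled Artin group. *)

(* Defs.v *)
From HB Require Import structures.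
From mathcomp Require Import all_boot all_order all_algebra.
From mathcomp Require Import boolp.

Set Implicit Arguments.
Unset Strict Implicit.
Unset Printing Implicit Defensive.

(* The letter (x, false) stands for the generator x, and (x, true) for its
   formal inverse. *)
Definition word (X : Type) := seq (X * bool).

Section Presentation.

Local Open Scope quotient_scope.

Variables (X : choiceType) (R : word X -> Prop).

(* The congruence on words whose quotient is the group < X | R >; its
   compatibility with concatenation, [word_cong_cat], comes from the contexts
   u and v in the two elementary moves. *)
Inductive word_cong : word X -> word X -> Prop :=
| word_cong_refl u : word_cong u u
| word_cong_sym u v : word_cong u v -> word_cong v u
| word_cong_trans v u w : word_cong u v -> word_cong v w -> word_cong u w
| word_cong_relator u r v : R r -> word_cong (u ++ r ++ v) (u ++ v)
| word_cong_cancel u x b v :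
    word_cong (u ++ [:: (x, b), (x, ~~ b) & v]) (u ++ v).

Definition word_congb : rel (word X) := fun u v => `[< word_cong u v >].

Lemma word_congb_refl : reflexive word_congb.
Proof. by move=> u; apply/asboolP; exact: word_cong_refl. Qed.

Lemma word_congb_sym : symmetric word_congb.
Proof. by move=> u v; apply/asboolP/asboolP; exact: word_cong_sym. Qed.

Lemma word_congb_trans : transitive word_congb.
Proof.
move=> v u w /asboolP uv /asboolP vw.
by apply/asboolP; exact: word_cong_trans uv vw.
Qed.

Canonical word_congb_equiv :=
  EquivRel word_congb word_congb_refl word_congb_sym word_congb_trans.

Definition presented := {eq_quot word_congb}.

HB.instance Definition _ := Choice.on presented.
HB.instance Definition _ := EqQuotient.on presented.

Lemma eq_presented u v : word_cong u v <-> \pi_presented u = \pi_presented v.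
Proof.
split=> [uv|/eqP]; last by rewrite piE => /asboolP.
by apply/eqP; rewrite piE; apply/asboolP.
Qed.

Lemma word_cong_ctx p s u v :
  word_cong u v -> word_cong (p ++ u ++ s) (p ++ v ++ s).
Proof.
elim=> {u v} [u|u v _ ih|v u w _ ih1 _ ih2|u r v Rr|u x b v].
- exact: word_cong_refl.
- exact: word_cong_sym.
- exact: word_cong_trans ih1 ih2.
- by rewrite -!catA !(catA p); exact: word_cong_relator.
- by rewrite -!catA !(catA p) /=; exact: word_cong_cancel.
Qed.

Lemma word_cong_cat u u' v v' :
  word_cong u u' -> word_cong v v' -> word_cong (u ++ v) (u' ++ v').
Proof.
move=> /(word_cong_ctx [::] v) uu' /(word_cong_ctx u' [::]).
by rewrite !cats0; exact: word_cong_trans.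
Qed.

Definition word_inv (u : word X) : word X :=
  rev [seq (l.1, ~~ l.2) | l <- u].

Lemma word_invK : involutive word_inv.
Proof.
move=> u; rewrite /word_inv map_rev revK -map_comp map_id_in // => -[x b] _ /=.
by rewrite negbK.
Qed.

Lemma word_inv_cat u v : word_inv (u ++ v) = word_inv v ++ word_inv u.
Proof. by rewrite /word_inv map_cat rev_cat. Qed.

Lemma word_mulV u : word_cong (u ++ word_inv u) [::].
Proof.
elim: u => [|[x b] u ih]; first exact: word_cong_refl.
rewrite -cat1s word_inv_cat -catA (catA u).
apply: word_cong_trans (word_cong_ctx [:: (x, b)] _ ih) _.
exact: (word_cong_cancel [::] x b [::]).
Qed.

Lemma word_mulVl u : word_cong (word_inv u ++ u) [::].
Proof. by rewrite -{2}[u]word_invK; exact: word_mulV. Qed.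

Lemma word_cong_inv u v : word_cong u v -> word_cong (word_inv u) (word_inv v).
Proof.
move=> uv.
apply: (@word_cong_trans (word_inv u ++ v ++ word_inv v)).
  rewrite -[X in word_cong X _]cats0; apply: word_cong_cat.
    exact: word_cong_refl.
  by apply: word_cong_sym; exact: word_mulV.
rewrite catA -[X in word_cong _ X]cat0s; apply: word_cong_cat.
  apply: word_cong_trans (word_mulVl u).
  by apply: word_cong_cat; [exact: word_cong_refl|exact: word_cong_sym].
exact: word_cong_refl.
Qed.

Definition presented_mul (a b : presented) : presented :=
  \pi_presented (repr a ++ repr b).

Definition presented_one : presented := \pi_presented [::].

Definition presented_inv (a : presented) : presented :=
  \pi_presented (word_inv (repr a)).

Lemma word_cong_repr u : word_cong (repr (\pi_presented u)) u.
Proof. by apply/eq_presented; rewrite reprK. Qed.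

Lemma presented_mulE u v :
  presented_mul (\pi_presented u) (\pi_presented v) = \pi_presented (u ++ v).
Proof. by apply/eq_presented/word_cong_cat; exact: word_cong_repr. Qed.

Lemma presented_invE u :
  presented_inv (\pi_presented u) = \pi_presented (word_inv u).
Proof. by apply/eq_presented/word_cong_inv; exact: word_cong_repr. Qed.

Lemma presented_mulA : associative presented_mul.
Proof.
move=> a b c; rewrite -[a]reprK -[b]reprK -[c]reprK.
rewrite (presented_mulE (repr a) (repr b)) (presented_mulE (repr b) (repr c)).
by rewrite !presented_mulE catA.
Qed.

Lemma presented_mul1g : left_id presented_one presented_mul.
Proof. by move=> a; rewrite -[a]reprK presented_mulE. Qed.

Lemma presented_mulg1 : right_id presented_one presented_mul.
Proof. by move=> a; rewrite -[a]reprK presented_mulE cats0. Qed.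

Lemma presented_mulVg : left_inverse presented_one presented_inv presented_mul.
Proof.
move=> a; rewrite -[a]reprK presented_invE presented_mulE.
exact/eq_presented/word_mulVl.
Qed.

Lemma presented_mulgV : right_inverse presented_one presented_inv presented_mul.
Proof.
move=> a; rewrite -[a]reprK presented_invE presented_mulE.
exact/eq_presented/word_mulV.
Qed.

HB.instance Definition _ := isGroup.Build presented
  presented_mulA presented_mul1g presented_mulg1
  presented_mulVg presented_mulgV.

End Presentation.

(* Graphs may be infinite. *)
Record sgraph := SGraph {
  vertex :> choiceType;
  edge : rel vertex;
  edge_sym : symmetric edge;
  edge_irrefl : irreflexive edge
}.

Definition commutator_word (X : Type) (x y : X) : word X :=
  [:: (x, true); (y, true); (x, false); (y, false)].

Definition raag_relator (Gamma : sgraph) (w : word Gamma) : Prop :=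
  exists v v' : Gamma, edge v v' /\ w = commutator_word v v'.

Definition raag (Gamma : sgraph) : groupType :=
  presented (@raag_relator Gamma).

Definition is_raag (G : groupType) : Prop :=
  exists (Gamma : sgraph) (f : {multiplicative raag Gamma -> G}), bijective f.

Definition finitely_generated (G : groupType) : Prop :=
  exists s : seq G, forall S : {pred G},
    group_closed S -> {subset s <= S} -> forall x, x \in S.

Definition embeds (H G : groupType) : Prop :=
  exists f : {multiplicative H -> G}, injective f.

Record gmodule (G : groupType) := GModule {
  gmodule_sort :> zmodType;
  gact : G -> gmodule_sort -> gmodule_sort;
  gact1 : forall m, gact 1%g m = m;
  gactM : forall g h m, gact (g * h)%g m = gact g (gact h m);
  gactD : forall g m n, gact g (m + n)%R = (gact g m + gact g n)%R
}.

Section Cohomology.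

Local Open Scope ring_scope.

Variables (G : groupType) (M : gmodule G).

(* Together with [equivariant], the complex Hom_ZG(F, M) where F is the
   standard resolution of Z over ZG: F_n is the free abelian group on
   G^(n+1), with the diagonal action of G. *)
Definition cochain (n : nat) := {ffun 'I_n.+1 -> G} -> M.

Definition equivariant n (c : cochain n) : Prop :=
  forall g (x : {ffun 'I_n.+1 -> G}),
    c [ffun i => (g * x i)%g] = gact g (c x).

Definition coboundary_map n (c : cochain n) : cochain n.+1 :=
  fun x => \sum_(i < n.+2) c [ffun j => x (lift i j)] *~ (-1) ^+ i.

Definition is_cocycle n (c : cochain n) : Prop :=
  equivariant c /\ forall x, coboundary_map c x = 0.

Definition is_coboundary n : cochain n -> Prop :=
  match n with
  | 0 => fun c => forall x, c x = 0
  | n'.+1 => fun c => exists b : cochain n',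
      equivariant b /\ forall x, c x = coboundary_map b x
  end.

(* H^n(G; M) = 0 *)
Definition cohomology_trivial n : Prop :=
  forall c : cochain n, is_cocycle c -> is_coboundary c.

End Cohomology.

(* cd G = n, where cd G is the largest n such that H^n(G; M) <> 0 for some
   ZG-module M. *)
Definition has_cd (G : groupType) (n : nat) : Prop :=
  (exists M : gmodule G, ~ cohomology_trivial M n) /\
  forall m, n < m -> forall M : gmodule G, cohomology_trivial M m.

Definition fg_raag_of_dim (n : nat) (G : groupType) : Prop :=
  [/\ finitely_generated G, is_raag G & has_cd G n].

Definition universal_raag (n : nat) (G : groupType) : Prop :=
  fg_raag_of_dim n G /\
  forall H : groupType, fg_raag_of_dim n H -> embeds H G.

(* Main.v *)
(* Let u be a vertex of Gamma and N the kernel of the endomorphism of A(Gamma)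
   killing u; N is free on the conjugates of u by the subgroup generated by the
   other vertices.  If {a, a'} commutes with {b, b'} and both commutators
   [a, a'] and [b, b'] lie in N, then one of them is trivial: if y = [b, b'] is
   not 1, then a and a' fix the attracting end y^oo of y, on whose stabilizer
   the Busemann displacement is a homomorphism to Z; hence [a, a'] is an element
   of the free group N that fixes y^oo with displacement 0, which forces
   [a, a'] = 1.

   Now let Lambda be a finite triangle-free graph in which every vertex p has a
   non-adjacent twin p' with the same neighbours, and embed A(Lambda) into
   A(Gamma), where A(Gamma) is generated by u_1, ..., u_k.  Colour p by the
   least i such that killing u_1, ..., u_i kills the image of [p, p'].
   By the above, the colouring is proper, so the chromatic number of Lambda is
   at most k, independently of Lambda.  The shift graphs, with vertices doubled,
   violate this bound.  They do define groups of cohomological dimension 2: by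
   induction on a finite triangle-free graph, A(u + P) is an HNN extension of
   A(P) over the free group on the neighbours of u in P. *)

Require Import Defs.
From mathcomp Require Import all_boot.
From HB Require Import structures.
From mathcomp Require Import all_algebra fingroup perm generic_quotient.
From mathcomp Require Import boolp zify ring.

Set Implicit Arguments.
Unset Strict Implicit.
Unset Printing Implicit Defensive.

(** * Homomorphisms and actions of right-angled Artin groups *)

Section Raag.

Local Open Scope quotient_scope.
Local Open Scope group_scope.

Variable Gamma : sgraph.

Definition of_word (w : word Gamma) : raag Gamma :=
  \pi_(presented (@raag_relator Gamma)) w.

Definition letter (v : Gamma) (b : bool) : raag Gamma := of_word [:: (v, b)].

Definition gen (v : Gamma) : raag Gamma := letter v false.

Lemma of_wordK (g : raag Gamma) : of_word (repr g) = g.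
Proof. exact: reprK. Qed.

Lemma of_word_cat u v : of_word (u ++ v) = of_word u * of_word v.
Proof. by rewrite [RHS]presented_mulE. Qed.

Lemma of_word_cons v b w : of_word ((v, b) :: w) = letter v b * of_word w.
Proof. exact: of_word_cat [:: _] w. Qed.

Lemma letterV v b : letter v (~~ b) = (letter v b)^-1.
Proof. by rewrite [RHS]presented_invE. Qed.

Lemma gen_commute v v' : edge v v' -> commute (gen v) (gen v').
Proof.
move=> e; apply/commgP/eqP.
rewrite commgEl conjgE -!(letterV _ false) /gen /=.
have -> : letter v true * (letter v' true * (letter v false * letter v' false))
          = of_word (commutator_word v v').
  by rewrite /commutator_word 3!of_word_cons.
apply/eq_presented.
apply: (@word_cong_relator _ _ [::] (commutator_word v v') [::]).
by exists v, v'.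
Qed.

Lemma raag_ind (P : raag Gamma -> Prop) :
  P 1 -> (forall v b g, P g -> P (letter v b * g)) -> forall g, P g.
Proof.
move=> P1 PM g; rewrite -[g]of_wordK.
by elim: (repr g) => [|[v b] w ih] //; rewrite of_word_cons; exact: PM.
Qed.

Section Action.

(** The relations are required only on the invariant set [I]: below, [push] is invertible only on
    reduced infinite words. *)
Variables (S : Type) (I : S -> Prop) (f : Gamma -> bool -> S -> S).
Hypothesis f_stable : forall v b s, I s -> I (f v b s).
Hypothesis fK : forall v b s, I s -> f v b (f v (~~ b) s) = s.
Hypothesis f_commute : forall v v' s, edge v v' -> I s ->
  f v false (f v' false s) = f v' false (f v false s).

Definition word_act (w : word Gamma) (s : S) := foldr (fun l => f l.1 l.2) s w.

Definition raag_act (g : raag Gamma) : S -> S := word_act (repr g).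

Lemma word_act_stable w s : I s -> I (word_act w s).
Proof. by move=> Is; elim: w => //= -[v b] w; exact: f_stable. Qed.

Lemma word_act_cong u w s : word_cong (@raag_relator Gamma) u w -> I s ->
  word_act u s = word_act w s.
Proof.
move=> uw; elim: uw s => {u w} //.
- by move=> u w _ ih s /ih.
- by move=> u v w _ ih1 _ ih2 s Is; rewrite ih1 // ih2.
- move=> u _ w [v [v' [e ->]]] s Is; rewrite /word_act !foldr_cat /=.
  have Iw := word_act_stable w Is; rewrite -!/(word_act _ _).
  congr word_act; rewrite f_commute //.
  rewrite (fK v' true); last exact: f_stable.
  exact: (fK v true).
- move=> u v b w s Is; rewrite /word_act !foldr_cat /= -!/(word_act _ _).
  by rewrite fK //; exact: word_act_stable.
Qed.

Lemma raag_act_of_word w s : I s -> raag_act (of_word w) s = word_act w s.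
Proof. by move=> Is; apply: word_act_cong => //; exact: word_cong_repr. Qed.

Lemma raag_act_stable g s : I s -> I (raag_act g s).
Proof. exact: word_act_stable. Qed.

Lemma raag_act1 s : I s -> raag_act 1 s = s.
Proof. exact: (raag_act_of_word [::]). Qed.

Lemma raag_actM g h s : I s ->
  raag_act (g * h) s = raag_act g (raag_act h s).
Proof.
move=> Is; rewrite -[g in LHS]of_wordK -[h in LHS]of_wordK -of_word_cat.
by rewrite raag_act_of_word // /word_act foldr_cat.
Qed.

Lemma raag_act_letter v b s : I s -> raag_act (letter v b) s = f v b s.
Proof. exact: raag_act_of_word. Qed.

End Action.

End Raag.

Section Lift.

Local Open Scope group_scope.

Variables (Gamma : sgraph) (H : groupType) (h : Gamma -> H).
Hypothesis h_commute : forall v v', edge v v' -> commute (h v) (h v').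

Let f v (b : bool) x := (if b then (h v)^-1 else h v) * x.

(* The proof is an argument so that the morphism structure below is inferred. *)
Definition raag_lift of (forall v v', edge v v' -> commute (h v) (h v')) :=
  fun g : raag Gamma => raag_act f g 1.

Let I (x : H) := True.

Let f_stable v b s : I s -> I (f v b s). Proof. by []. Qed.

Let fK v b s : I s -> f v b (f v (~~ b) s) = s.
Proof. by rewrite /f; case: b => _ /=; rewrite ?mulKg ?mulVKg. Qed.

Let f_commute v v' s : edge v v' -> I s ->
  f v false (f v' false s) = f v' false (f v false s).
Proof. by move=> e _; rewrite /f /= !mulgA (h_commute e). Qed.

Lemma raag_lift_letter v b :
  raag_lift h_commute (letter v b) = if b then (h v)^-1 else h v.
Proof.
by rewrite /raag_lift (raag_act_letter f_stable fK f_commute) // /f mulg1.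
Qed.

Lemma raag_lift_gen v : raag_lift h_commute (gen v) = h v.
Proof. exact: raag_lift_letter. Qed.

Lemma raag_lift_is_monoid_morphism : monoid_morphism (raag_lift h_commute).
Proof.
have actM := raag_actM f_stable fK f_commute.
have act1 := raag_act1 f_stable fK f_commute.
split=> [|g g']; first exact: act1.
rewrite /raag_lift actM //; set x := raag_act f g' 1.
elim/raag_ind: g x => [|v b g ih] x; first by rewrite !act1 // mul1g.
by rewrite !actM // ih !(raag_act_letter f_stable fK f_commute) // /f mulgA.
Qed.

HB.instance Definition _ := isUMagmaMorphism.Build (raag Gamma) H
  (raag_lift h_commute) raag_lift_is_monoid_morphism.

End Lift.

Section Restrict.

Local Open Scope group_scope.

Variables (Gamma : sgraph) (P : pred Gamma).

Definition restrict_gen v : raag Gamma := if P v then gen v else 1.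

Lemma restrict_gen_commute v v' :
  edge v v' -> commute (restrict_gen v) (restrict_gen v').
Proof.
rewrite /restrict_gen => e.
case: (P v); case: (P v'); last exact: commute1.
- exact: gen_commute.
- exact: commute1.
- exact/commute_sym/commute1.
Qed.

Definition restrict := raag_lift restrict_gen_commute.

HB.instance Definition _ := UMagmaMorphism.copy restrict
  (raag_lift restrict_gen_commute).

Lemma restrict_letter v b :
  restrict (letter v b) = if P v then letter v b else 1.
Proof.
rewrite /restrict raag_lift_letter /restrict_gen.
by case: (P v); case: b => //; rewrite ?(letterV _ false) ?invg1.
Qed.

Lemma restrict1 : restrict 1 = 1.
Proof. exact: gmulf1. Qed.

Lemma restrictM : {morph restrict : g h / g * h}.
Proof. exact: gmulfM. Qed.

End Restrict.

(** * The free group action on infinite reduced words *)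

Section InfiniteWords.

Local Open Scope group_scope.

Variable G : groupType.

Local Notation L := (G * bool)%type.

Definition linv (l : L) : L := (l.1, ~~ l.2).

Definition lconj (g : G) (l : L) : L := (l.1 ^ g^-1, l.2).

Definition lelt (l : L) : G := if l.2 then l.1^-1 else l.1.

Definition evalw (w : seq L) : G := \prod_(l <- w) lelt l.

Definition icons (l : L) (xi : nat -> L) i := if i is j.+1 then xi j else l.

Definition icat (p : seq L) (xi : nat -> L) := foldr icons xi p.

Definition ireduced (xi : nat -> L) := forall i, xi i.+1 != linv (xi i).

Definition reduced (w : seq L) := sorted (fun l l' => l' != linv l) w.

Definition periodic (w : seq L) i := nth (1, false) w (i %% size w).

(* The second component records the Busemann displacement. *)
Definition state := ((nat -> L) * int)%type.

(** Left multiplication by [l] on the boundary of a free group. *)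
Definition push (l : L) (s : state) : state :=
  if s.1 0 == linv l then (s.1 \o S, s.2 - 1)%R else (icons l s.1, s.2 + 1)%R.

Definition translate (g : G) (s : state) : state := (lconj g \o s.1, s.2).

Lemma linvK : involutive linv.
Proof. by case=> x b; rewrite /linv negbK. Qed.

Lemma linv_neq l : l != linv l.
Proof. by case: l => x [] /=; rewrite /linv xpair_eqE eqxx. Qed.

Lemma lconj1 l : lconj 1 l = l.
Proof. by case: l => x b; rewrite /lconj invg1 conjg1. Qed.

Lemma lconjM g h l : lconj (g * h) l = lconj g (lconj h l).
Proof. by rewrite /lconj invgM conjgM. Qed.

Lemma lconj_inj g : injective (lconj g).
Proof.
by move=> [x b] [x' b'] [xx' ->]; congr pair; exact: conjg_inj xx'.
Qed.

Lemma lelt_linv l : lelt (linv l) = (lelt l)^-1.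
Proof. by case: l => x [] //=; rewrite /lelt /= invgK. Qed.

Lemma lelt_lconj g l : lelt (lconj g l) = g * lelt l * g^-1.
Proof. by case: l => x []; rewrite /lelt /= ?conjgE invgK ?gnorm. Qed.

Lemma evalw_cons l w : evalw (l :: w) = lelt l * evalw w.
Proof. exact: big_cons. Qed.

Lemma evalw_cat w w' : evalw (w ++ w') = evalw w * evalw w'.
Proof. exact: big_cat. Qed.

Lemma evalw_inv w : evalw (rev (map linv w)) = (evalw w)^-1.
Proof.
elim: w => [|l w ih]; first by rewrite /evalw big_nil invg1.
rewrite map_cons rev_cons -cats1 evalw_cat ih !evalw_cons /evalw big_nil.
by rewrite lelt_linv invgM mulg1.
Qed.

Lemma translate1 s : translate 1 s = s.
Proof.
by case: s => xi k; congr pair; apply/funext => i; exact: lconj1.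
Qed.

Lemma translateM g h s : translate (g * h) s = translate g (translate h s).
Proof. by congr pair; apply/funext => i; exact: lconjM. Qed.

Lemma translate_ireduced g s : ireduced s.1 -> ireduced (translate g s).1.
Proof. by move=> r i; rewrite /= (inj_eq (@lconj_inj g) _ (linv _)) r. Qed.

Lemma push_ireduced l s : ireduced s.1 -> ireduced (push l s).1.
Proof.
rewrite /push => r; case: eqP => [_|/eqP n] i /=; first exact: r.
by case: i => [|i]; [exact: n|exact: r].
Qed.

Lemma pushK l s : ireduced s.1 -> push (linv l) (push l s) = s.
Proof.
case: s => xi k r; rewrite /push /=; case: (xi 0 =P linv l) => [e|_] /=.
  have := r 0; rewrite [(_, _).1]/= e => /negPf ->; rewrite GRing.subrK.
  congr pair.
  by apply/funext => -[] //=.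
by rewrite linvK eqxx GRing.addrK.
Qed.

Lemma translate_push g l s :
  translate g (push l s) = push (lconj g l) (translate g s).
Proof.
rewrite /push /= (inj_eq (@lconj_inj g) _ (linv _)); case: eqP => // _.
by congr pair; apply/funext => -[].
Qed.

Lemma icat_cat p q xi : icat (p ++ q) xi = icat p (icat q xi).
Proof. exact: foldr_cat. Qed.

Lemma icat_nth p xi i : i < size p -> icat p xi i = nth (1, false) p i.
Proof. by elim: p i => // l p ih [|i] //=; exact: ih. Qed.

Lemma icat_inj p q xi zeta :
  size p = size q -> icat p xi = icat q zeta -> p = q.
Proof.
move=> e pq; apply: (@eq_from_nth _ (1, false)) => // i ip.
by rewrite -(icat_nth xi ip) pq icat_nth // -e.
Qed.

Lemma icat_periodic w : icat w (periodic w) = periodic w.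
Proof.
have H p xi i : icat p xi (size p + i) = xi i by elim: p.
apply/funext => i; case: (ltnP i (size w)) => iw.
  by rewrite icat_nth // /periodic modn_small.
by rewrite -(subnKC iw) H /periodic modnDl.
Qed.

Lemma icat_reduced p xi : ireduced (icat p xi) -> reduced p.
Proof.
elim: p => // l [|l' p] ih //= r; rewrite (r 0) /=.
by apply: ih => i; exact: (r i.+1).
Qed.

Lemma foldr_push_icat p xi k : ireduced (icat p xi) ->
  foldr push (xi, k) p = (icat p xi, k + (size p)%:Z)%R.
Proof.
elim: p => [|l p ih] /= r; first by rewrite GRing.addr0.
rewrite ih => [|i]; last exact: (r i.+1).
rewrite /push /=; have /negPf -> := r 0.
by congr pair; rewrite -GRing.addrA -PoszD addn1.
Qed.

(** Letters act from the last to the first; once one has been added, reducedness of [w] forbids any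
    further cancellation. The prefix [q] of [xi] is what gets cancelled. *)
Lemma foldr_push_reduced w xi k : reduced w -> exists p q zeta,
  [/\ w = p ++ rev (map linv q), xi = icat q zeta &
      foldr push (xi, k) w
      = (icat p zeta, k + (size p)%:Z - (size q)%:Z)%R].
Proof.
elim: w => [|l w ih] r.
  by exists [::], [::], xi; rewrite /= GRing.addr0 GRing.subr0.
have [p [q [zeta [ew -> e]]]] := ih (path_sorted r).
rewrite /= e /push /=; case: p ew {e} => [|l' p] /= ew; last first.
  have /negPf -> : l' != linv l by move: r; rewrite ew /= => /andP[].
  exists (l :: l' :: p), q, zeta.
  by split; [rewrite ew| |congr pair => /=; lia].
case: eqP => [z0|_].
  exists [::], (rcons q (linv l)), (zeta \o S); split.
  - by rewrite map_rcons rev_rcons linvK ew.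
  - by rewrite -cats1 icat_cat /=; congr icat; apply/funext => -[].
  - by congr pair; rewrite size_rcons /=; lia.
by exists [:: l], q, zeta; split; [rewrite ew| |congr pair => /=; lia].
Qed.

(* w^m fixes eta while shifting it by m * size w, so no letter of w^m is
   cancelled and eta starts with w^m, for every m. *)
Lemma attracting_unique w eta : w != [::] -> ireduced (periodic w) ->
  (forall k, foldr push (eta, k) w = (eta, k + (size w)%:Z)%R) ->
  eta = periodic w.
Proof.
move=> w0 rw ew; pose W m := flatten (nseq m w).
have WP m : icat (W m) (periodic w) = periodic w.
  by elim: m => //= m ih; rewrite icat_cat ih icat_periodic.
have sW m : size (W m) = (m * size w)%N.
  by rewrite size_flatten /shape map_nseq sumn_nseq mulnC.
have eW m : foldr push (eta, 0%R) (W m) = (eta, Posz (m * size w)%N).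
  elim: m => //= m ih.
  by rewrite foldr_cat -/(W m) ih ew mulSn PoszD GRing.addrC.
apply/funext => i.
have iW : i < size (W i.+1).
  by rewrite sW leq_pmulr // lt0n size_eq0.
have rW : reduced (W i.+1) by apply: (@icat_reduced _ (periodic w)); rewrite WP.
have [p [q [zeta [eWp eq]]]] := foldr_push_reduced eta 0%R rW.
rewrite eW => -[ep]; rewrite -sW eWp size_cat size_rev size_map => epq.
have aux (m n : nat) : Posz (m + n) = (0 + Posz m - Posz n)%R -> n = 0.
  by lia.
have q0 : q = [::] by apply/size0nil/(aux (size p)).
move: eWp; rewrite q0 /= cats0 => eWp.
by rewrite ep -(WP i.+1) !icat_nth ?eWp // -eWp.
Qed.

(** Displacement 0 makes [p] and [q] equally long; as prefixes of the same infinite word they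
    coincide, so [w] is [p] followed by its inverse. *)
Lemma foldr_push_fixed w xi k : reduced w ->
  foldr push (xi, k) w = (xi, k) -> evalw w = 1.
Proof.
move=> rw fw; have [p [q [zeta [ew eq ep]]]] := foldr_push_reduced xi k rw.
move: ep; rewrite fw => -[exi ek].
have pq : size p = size q by lia.
by rewrite ew (icat_inj pq (_ : icat p zeta = icat q zeta)) -?eq // evalw_cat
  evalw_inv mulgV.
Qed.

End InfiniteWords.

Arguments push {G}.
Arguments linv {G}.

(** * The action of A(Gamma) on the ends of the kernel of killing a vertex *)

Section KillVertex.

Local Open Scope group_scope.

Variables (Gamma : sgraph) (u : Gamma).

Local Notation G := (raag Gamma).
Let kill : UMagmaMorphism.type G G := restrict (predC1 u).

(** The basis of the free kernel with signs: conjugates of [u] by the subgroup of the other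
    vertices. *)
Let bvalid (l : G * bool) := `[< exists b, l.1 = gen u ^ (kill b)^-1 >].

Local Notation istate := (state G).

Let I (s : istate) := ireduced s.1.

(** The kernel acts on its ends by left multiplication and the complementary subgroup by
    conjugation; together they give an action of the semidirect product. *)
Let f (v : Gamma) (b : bool) (s : istate) : istate :=
  if v == u then push (gen u, b) s else translate (letter v b) s.

Let f_stable v b s : I s -> I (f v b s).
Proof.
by rewrite /f; case: eqP => _; [exact: push_ireduced|exact: translate_ireduced].
Qed.

Let fK v b s : I s -> f v b (f v (~~ b) s) = s.
Proof.
rewrite /f; case: eqP => _ Is.
  by rewrite -{1}[b]negbK; exact: (@pushK _ (gen u, ~~ b)).
by rewrite letterV -translateM mulgV translate1.
Qed.

Let f_commute v v' s : edge v v' -> I s ->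
  f v false (f v' false s) = f v' false (f v false s).
Proof.
have push_comm w : edge u w ->
    push (gen u, false) (translate (gen w) s)
    = translate (gen w) (push (gen u, false) s).
  move=> e; rewrite translate_push; congr push; congr pair.
  by rewrite conjgE invgK mulgA -(gen_commute e) mulgK.
move=> e _; rewrite /f; case: eqP => [vu|_]; case: eqP => [v'u|_].
- by [].
- by rewrite push_comm // -vu.
- by rewrite push_comm // -v'u edge_sym.
- by rewrite -!translateM (gen_commute e).
Qed.

Let act := raag_act f.
Let actM := raag_actM f_stable fK f_commute.
Let act1 := raag_act1 f_stable fK f_commute.
Let act_letter := raag_act_letter f_stable fK f_commute.
Let act_stable := raag_act_stable f_stable.

Let kill_letter v b : kill (letter v b) = if v == u then 1 else letter v b.
Proof. by rewrite [LHS]restrict_letter /=; case: eqP. Qed.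

Let act_kill g s : I s -> act (kill g) s = translate (kill g) s.
Proof.
elim/raag_ind: g s => [|v b g ih] s Is.
  by rewrite gmulf1 translate1; exact: act1.
rewrite gmulfM /act actM // -/act ih // translateM kill_letter.
have Is' : I (translate (kill g) s) by exact: translate_ireduced.
case: (v =P u) => [_|/eqP/negPf e]; first by rewrite translate1; exact: act1.
by rewrite /act act_letter // /f e.
Qed.

Let act_lelt l s : I s -> bvalid l -> act (lelt l) s = push l s.
Proof.
move=> Is /asboolP[b lb].
have -> : lelt l = kill b * letter u l.2 * (kill b)^-1.
  rewrite /lelt lb conjgE invgK; case: l.2; last by rewrite mulgA.
  by rewrite (letterV _ false) !invgM invgK.
rewrite -gmulfV /act !actM //; last exact: act_stable.
rewrite -/act (act_kill _ Is).
have Is' : I (translate (kill b^-1) s) by exact: translate_ireduced.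
rewrite [act (letter u _) _]act_letter // /f eqxx.
rewrite act_kill; last exact: push_ireduced.
rewrite translate_push -translateM -gmulfM mulgV gmulf1 translate1.
by congr push; rewrite /lconj -lb; case: (l).
Qed.

Let act_evalw w s : I s -> all bvalid w -> act (evalw w) s = foldr push s w.
Proof.
move=> Is; elim: w => [|l w ih] /=.
  by rewrite /evalw big_nil => _; exact: act1.
case/andP => vl vw; have Iw : I (act (evalw w) s) by exact: act_stable.
by rewrite evalw_cons /act actM // -/act act_lelt // ih.
Qed.

Let shift (j : int) (s : istate) : istate := (s.1, s.2 + j)%R.

Let act_shift g j s : act g (shift j s) = shift j (act g s).
Proof.
rewrite /act /raag_act; elim: (repr g) => //= -[v b] w ih; rewrite ih /=.
rewrite /f; case: eqP => // _; rewrite /push /shift /=.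
by case: eqP => // _; congr pair => /=; rewrite GRing.addrAC.
Qed.

Let evalw_lconj (b : G) w : evalw (map (lconj b) w) = b * evalw w * b^-1.
Proof.
elim: w => [|l w ih]; first by rewrite /evalw big_nil mulg1 mulgV.
by rewrite map_cons !evalw_cons ih lelt_lconj !mulgA mulgVK.
Qed.

(** Semidirect product decomposition: a generator other than [u] moves past the word by conjugating
    its letters. *)
Let kill_decomp g : exists2 w, all bvalid w & g = evalw w * kill g.
Proof.
elim/raag_ind: g => [|v b g [w vw ew]].
  by exists [::]; rewrite // /evalw big_nil gmulf1 mulg1.
rewrite gmulfM kill_letter; case: (v =P u) => [->|/eqP/negPf vu].
  exists ((gen u, b) :: w) => /=.
    by rewrite vw andbT; apply/asboolP; exists 1; rewrite gmulf1 invg1 conjg1.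
  rewrite evalw_cons mul1g -mulgA -ew; congr mul.
  by rewrite /lelt /=; case: b; rewrite // -(letterV _ false).
exists (map (lconj (letter v b)) w).
  rewrite all_map; apply: sub_all vw => l /= /asboolP[c lc].
  apply/asboolP; exists (letter v b * c).
  by rewrite gmulfM kill_letter vu /= lc invgM conjgM.
by rewrite evalw_lconj {1}ew !mulgA mulgVK.
Qed.

Let reduce_word w : all bvalid w ->
  exists w', [/\ all bvalid w', reduced w' & evalw w' = evalw w].
Proof.
elim: w => [|l w ih] /=; first by exists [::].
case/andP => vl /ih[w' [vw' rw' ew]].
case: w' vw' rw' ew => [|l' w'] /= vw' rw' ew.
  by exists [:: l]; rewrite /= vl !evalw_cons -ew.
case: (l' =P linv l) => [el|/eqP nl]; last first.
  exists [:: l, l' & w']; rewrite /= vl vw' nl rw'; split=> //.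
  by rewrite [LHS]evalw_cons ew evalw_cons.
case/andP: vw' => _ vw'; exists w'; split => //; first exact: path_sorted rw'.
by rewrite [RHS]evalw_cons -ew evalw_cons el lelt_linv mulVKg.
Qed.

Let kernel_word g : kill g = 1 ->
  exists w, [/\ all bvalid w, reduced w & g = evalw w].
Proof.
move=> kg; have [w vw] := kill_decomp g; rewrite kg mulg1 => ->.
by have [w' [? ? <-]] := reduce_word vw; exists w'.
Qed.

(* A shortest word representing a conjugate of y is cyclically reduced. *)
Let kernel_cyclic y : kill y = 1 -> y != 1 ->
  exists h w, [/\ all bvalid w, w != [::], ireduced (periodic w) &
                  y ^ h = evalw w].
Proof.
move=> ky y1.
pose Q n := exists h w, [/\ all bvalid w, size w = n & y ^ h = evalw w].
have exQ : exists n, `[< Q n >].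
  have [w [vw _ ew]] := kernel_word ky.
  by exists (size w); apply/asboolP; exists 1, w; rewrite conjg1.
case: (ex_minnP exQ) => n /asboolP[h [w [vw sw ew]]] minn; exists h, w.
have w0 : w != [::].
  apply: contra_neq y1 => w0; apply/eqP; rewrite -(conjg_eq1 y h) ew w0.
  by rewrite /evalw big_nil.
split=> // i; have sw0 : 0 < size w by rewrite lt0n size_eq0.
apply/negP => /eqP e.
have iw : i %% size w < size w by rewrite ltn_mod.
(* The cancelling pair may straddle the end of [w]; the rotation [r] represents another conjugate of
   [y] and has the pair in front. *)
pose r := rot (i %% size w) w.
have r_nth j : j < size w -> nth (1, false) r j = periodic w (i + j).
  move=> jw; rewrite /r /rot nth_cat size_drop /periodic -modnDml.
  set k := i %% size w in iw *.
  case: ltnP => kj; first by rewrite nth_drop modn_small -?ltn_subRL.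
  have le : size w <= k + j by rewrite -leq_subLR.
  have lt : k + j - size w < k by rewrite ltn_subLR // addnC ltn_add2r.
  have -> : j - (size w - k) = k + j - size w by rewrite subnBA 1?ltnW // addnC.
  rewrite nth_take // -[in RHS](subnK le) modnDr modn_small //.
  exact: ltn_trans lt iw.
have er : evalw r = y ^ (h * evalw (take (i %% size w) w)).
  rewrite conjgM ew -[X in evalw X ^ _](cat_take_drop (i %% size w)).
  by rewrite conjgE /r /rot !evalw_cat !mulgA mulVg mul1g.
have vr : all bvalid r by rewrite (eq_all_r (mem_rot _ w)).
have sr : size r = size w by exact: size_rot.
case: r sr vr er r_nth => [|l [|l' r]] sr vr er r_nth.
- by rewrite -sr in sw0.
- have := r_nth 0; rewrite addn0 -sr => /(_ isT) /= el.
  have : periodic w i.+1 = periodic w i by rewrite /periodic -sr !modn1.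
  by rewrite e -el => /esym/eqP; rewrite (negPf (linv_neq l)).
- have := r_nth 0; have := r_nth 1%N; rewrite -sr addn0 addn1 /= => /(_ isT) e1.
  move=> /(_ isT) e0; have : n <= size r.
    apply: minn; apply/asboolP; exists (h * evalw (take (i %% size w) w)), r.
    case/and3P: vr => _ _ vr; split=> //.
    by rewrite -er !evalw_cons e1 e -e0 lelt_linv mulVKg.
  by rewrite -sw -sr /=; lia.
Qed.

Lemma kill_commutator_trivial y a a' :
  restrict (predC1 u) y = 1 -> y != 1 -> commute y a -> commute y a' ->
  restrict (predC1 u) [~ a, a'] = 1 -> [~ a, a'] = 1.
Proof.
have kE x : restrict (predC1 u) x = kill x by [].
rewrite !{}kE => ky y1; have [h [w [vw w0 rw ew]]] := kernel_cyclic ky y1.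
wlog h1 : y a a' h ky y1 ew / h = 1 => [wl ya ya' kaa'|].
  apply/eqP; rewrite -(conjg_eq1 _ h) conjRg; apply/eqP.
  apply: (wl (y ^ h) _ _ 1) => //.
  - by rewrite gmulfJ ky conj1g.
  - by rewrite conjg_eq1.
  - by rewrite conjg1.
  - by rewrite /commute -!conjMg ya.
  - by rewrite /commute -!conjMg ya'.
  - by rewrite -conjRg gmulfJ kaa' conj1g.
rewrite {}h1 conjg1 in ew => ya ya' kx.
have Ixi k : I (periodic w, k) by [].
(* As [b] commutes with [y], the element [y] acts on the image [eta] of the attracting end with
   displacement [size w] too; uniqueness shows that [b] fixes this end. *)
have stab b : commute y b -> exists j : int,
    forall k, act b (periodic w, k) = (periodic w, k + j)%R.
  move=> yb; pose eta := (act b (periodic w, 0%R)).1.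
  pose j := (act b (periodic w, 0%R)).2.
  have eb k : act b (periodic w, k) = (eta, k + j)%R.
    have -> : (periodic w, k) = shift k (periodic w, 0%R).
      by congr pair; rewrite /= GRing.add0r.
    by rewrite act_shift /shift GRing.addrC.
  suff e : eta = periodic w by exists j => k; rewrite eb e.
  apply: (attracting_unique w0) => // k.
  have Ie k' : I (eta, k').
    by rewrite -[k'](GRing.subrK j) -eb; exact: act_stable.
  rewrite -act_evalw // -ew -[k](GRing.subrK j) -eb /act -!actM // yb.
  rewrite !actM // -!/act ew act_evalw // foldr_push_icat ?icat_periodic //.
  by rewrite eb [in LHS]GRing.addrAC.
have stabV b (j : int) :
    (forall k, act b (periodic w, k) = (periodic w, k + j)%R) ->
    forall k, act b^-1 (periodic w, k) = (periodic w, k - j)%R.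
  move=> eb k; rewrite -[X in act _ (_, X)](GRing.subrK j) -eb /act -actM //.
  by rewrite mulVg act1.
have [j ja] := stab _ ya; have [j' ja'] := stab _ ya'.
(* Displacements add up on the stabilizer of the end, so they cancel in a commutator. *)
have ax : act [~ a, a'] (periodic w, 0%R) = (periodic w, 0%R).
  rewrite commgEl conjgE /act !actM ?raag_act_stable // -/act.
  rewrite ja' ja (stabV _ _ ja') (stabV _ _ ja).
  by rewrite GRing.add0r (GRing.addrC j') GRing.addrK GRing.subrr.
have [w' [vw' rw' ew']] := kernel_word kx.
rewrite ew'; apply: (foldr_push_fixed (xi := periodic w) (k := 0%R) rw').
by rewrite -act_evalw // -ew'.
Qed.

End KillVertex.

(** * Colourings *)

Section Colouring.

Local Open Scope group_scope.

Variable Gamma : sgraph.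

Lemma restrict_comp (P Q : pred Gamma) g :
  restrict P (restrict Q g) = restrict (predI P Q) g.
Proof.
elim/raag_ind: g => [|v b g ih]; first by rewrite !restrict1.
rewrite !restrictM ih !restrict_letter /=; congr mul.
by case: (Q v); rewrite ?andbT ?andbF ?restrict1 ?restrict_letter.
Qed.

Lemma restrict_id (P : pred Gamma) g : (forall v, P v) -> restrict P g = g.
Proof.
move=> PT; elim/raag_ind: g => [|v b g ih]; first by rewrite restrict1.
by rewrite restrictM ih restrict_letter PT.
Qed.

Lemma eq_restrict (P Q : pred Gamma) : P =1 Q -> restrict P =1 restrict Q.
Proof.
move=> PQ; elim/raag_ind => [|v b g ih]; first by rewrite !restrict1.
by rewrite !restrictM ih !restrict_letter PQ.
Qed.

Lemma commuteR (G : groupType) (x y z : G) :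
  commute x y -> commute x z -> commute x [~ y, z].
Proof.
move=> xy xz; rewrite commgEl conjgE.
by do ![apply: commuteM || apply: commuteV] => //; exact/commute_sym.
Qed.

(* A vertex v is coloured by the first i such that killing the i first elements
   of U also kills [~ a v, a' v]. *)
Lemma commuting_pairs_colouring (U : seq Gamma) (V : Type) (E : V -> V -> Prop)
    (a a' : V -> raag Gamma) :
  (forall v w, E v w -> [/\ commute (a v) (a w), commute (a v) (a' w),
                            commute (a' v) (a w) & commute (a' v) (a' w)]) ->
  (forall v, restrict (fun x => x \notin U) [~ a v, a' v] = 1) ->
  exists c : V -> nat,
    (forall v, [~ a v, a' v] != 1 -> c v < size U) /\
    (forall v w, E v w -> [~ a v, a' v] != 1 -> [~ a w, a' w] != 1 ->
       c v <> c w).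
Proof.
elim: U a a' => [|u U ih] a a' aE aU.
  have a1 v : [~ a v, a' v] = 1 by rewrite -[RHS](aU v) restrict_id.
  by exists (fun=> 0); split=> [v|v w _]; rewrite a1 eqxx.
pose k : UMagmaMorphism.type _ _ := restrict (predC1 u).
have [||c [c_lt c_neq]] := ih (k \o a) (k \o a').
- by move=> v w /aE[]; split; exact: gmulf_commute.
- move=> v; rewrite /= -gmulfR restrict_comp -[RHS](aU v).
  by apply: eq_restrict => x; rewrite /= inE negb_or andbC.
exists (fun v => if k [~ a v, a' v] == 1 then 0 else (c v).+1).
split=> [v v1|v w vw v1 w1].
  by case: eqP => // /eqP kv; rewrite ltnS c_lt //= -gmulfR.
case: eqP => kv; case: eqP => kw //.
  (* Both colours are 0: both commutators die with [u] alone, and the one at [v] commutes with [a w]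
     and [a' w]. *)
  case/aE: vw => aa aa' a'a a'a'; case/eqP: w1.
  apply: (@kill_commutator_trivial _ u [~ a v, a' v]) => //.
  - by apply/commute_sym/commuteR; exact/commute_sym.
  - by apply/commute_sym/commuteR; exact/commute_sym.
by case; apply: c_neq => //=; rewrite -gmulfR; exact/eqP.
Qed.

(** [Gamma] may be infinite, but words for finitely many generators mention only finitely many
    vertices, and killing these kills every generator. *)
Lemma finitely_generated_support (G : groupType)
    (f : {multiplicative raag Gamma -> G}) :
  bijective f -> finitely_generated G ->
  exists U : seq Gamma, forall g, restrict (fun x => x \notin U) g = 1.
Proof.
case=> f' fK f'K [s sP].
have f'M := can2_gmulfM fK f'K.
have f'1 : f' 1 = 1 by apply: (@mulgI _ (f' 1)); rewrite -f'M !mulg1.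
have f'V x : f' x^-1 = (f' x)^-1.
  by apply/esym/mulg1_eq; rewrite -f'M mulgV.
pose U := flatten [seq map fst (repr (f' x)) | x <- s].
pose k : UMagmaMorphism.type _ _ := restrict (fun x => x \notin U).
exists U => g; rewrite -[g]fK -/(k _).
suff: f g \in [pred x | k (f' x) == 1] by rewrite inE => /eqP.
apply: sP => [|x xs].
  split=> [|x y]; rewrite !inE; first by rewrite f'1 gmulf1.
  by move=> /eqP kx /eqP ky; rewrite f'M f'V gmulfM gmulfV kx ky invg1 mulg1.
rewrite inE -[f' x]of_wordK.
have : all (fun l => l.1 \in U) (repr (f' x)).
  apply/allP => l lx; apply/flattenP; exists (map fst (repr (f' x))).
    by apply: map_f xs.
  exact: map_f.
elim: (repr _) => [|[v b] w ih] /= ; first by rewrite gmulf1.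
case/andP => vU /ih /eqP kw; rewrite of_word_cons gmulfM kw mulg1.
by rewrite [k _]restrict_letter vU.
Qed.

Lemma tperm_not_commute (T : finType) (x y z : T) :
  x != y -> y != z -> x != z -> ~ commute (tperm x y) (tperm y z).
Proof.
move=> xy yz xz /permP/(_ x).
rewrite !permM tpermL tpermL (@tpermD _ y z x) 1?eq_sym // tpermL => e.
by rewrite e eqxx in yz.
Qed.

(** Send [v] and [v'] to overlapping transpositions of three points and all other vertices to 1; no
    relation involves both, so this is a homomorphism. *)
Lemma gen_not_commute (v v' : Gamma) :
  v != v' -> ~~ edge v v' -> ~ commute (gen v) (gen v').
Proof.
move=> nvv' ne.
pose s := tperm None (Some true); pose s' := tperm (Some true) (Some false).
pose h x := if x == v then s else if x == v' then s' else 1.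
have hC x y : edge x y -> commute (h x) (h y).
  have hv z : z != v -> z != v' -> h z = 1.
    by rewrite /h => /negPf-> /negPf->.
  have [->|nx] := eqVneq x v; have [->|ny] := eqVneq y v.
  - by rewrite edge_irrefl.
  - have [->|ny'] := eqVneq y v'; first by rewrite (negPf ne).
    by rewrite (hv y) // => _; exact: commute1.
  - have [->|nx'] := eqVneq x v'; first by rewrite edge_sym (negPf ne).
    by rewrite (hv x) // => _; exact/commute_sym/commute1.
  - have [->|nx'] := eqVneq x v'; last first.
      by rewrite (hv x) // => _; exact/commute_sym/commute1.
    have [->|ny'] := eqVneq y v'; first by rewrite edge_irrefl.
    by rewrite (hv y) // => _; exact: commute1.
move=> vv'.
have : commute (raag_lift hC (gen v)) (raag_lift hC (gen v')).
  exact: gmulf_commute.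
rewrite !raag_lift_gen /h eqxx eq_sym (negPf nvv') eqxx.
exact: tperm_not_commute.
Qed.

End Colouring.

(** * Doubled shift graphs *)

Section ShiftGraph.

Variable n : nat.

Local Notation V := ('I_n * 'I_n * bool)%type.

(** Arcs go from (i, j) to (j, l) with i < j < l. The bit is ignored, so the two copies of a pair
    are non-adjacent twins. *)
Definition shift_arc (p q : V) :=
  [&& p.1.2 == q.1.1, p.1.1 < p.1.2 & q.1.1 < q.1.2].

Definition shift_edge (p q : V) := shift_arc p q || shift_arc q p.

Lemma shift_edge_sym : symmetric shift_edge.
Proof. by move=> p q; rewrite /shift_edge orbC. Qed.

Lemma shift_edge_irrefl : irreflexive shift_edge.
Proof.
move=> [[i j] b]; rewrite /shift_edge /shift_arc /=.
by case: eqP => //= ->; rewrite ltnn.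
Qed.

(* The vertices (i, j, b) with j <= i are isolated. *)
Definition doubled_shift_graph : sgraph :=
  SGraph shift_edge_sym shift_edge_irrefl.

Lemma shift_triangle_free (p q r : doubled_shift_graph) :
  edge p q -> edge q r -> edge p r -> False.
Proof.
case: p q r => [[i j] b] [[i' j'] b'] [[i'' j''] b''].
rewrite /= /shift_edge /shift_arc /= -!val_eqE /=; lia.
Qed.

(** Let [S i] collect the colours of the pairs starting at i. For i < j the colour of (i, j) lies in
    [S i] but not in [S j], so the n sets are distinct subsets of k colours. *)
Lemma shift_colouring k (c : 'I_n * 'I_n -> nat) :
  (forall i j : 'I_n, i < j -> c (i, j) < k) ->
  (forall i j l : 'I_n, i < j -> j < l -> c (i, j) <> c (j, l)) ->
  n <= 2 ^ k.
Proof.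
move=> c_lt c_neq.
pose S (i : 'I_n) :=
  [set x : 'I_k | [exists j : 'I_n, (i < j) && (c (i, j) == x)]].
have S_neq (i j : 'I_n) : i < j -> S i <> S j.
  move=> ij /setP /(_ (Ordinal (c_lt i j ij))); rewrite !inE.
  set lhs := [exists _, _]; have -> : lhs.
    by apply/existsP; exists j; rewrite ij /=.
  move=> /esym/existsP[l /andP[jl /eqP e]].
  by apply: (c_neq i j l).
have S_inj : injective S.
  move=> i j e; apply/val_inj/eqP; case: ltngtP => // ij.
    by case: (S_neq _ _ ij).
  by case: (S_neq _ _ ij).
have <- : #|{set 'I_k}| = 2 ^ k.
  by rewrite -cardsT -powersetT card_powerset cardsT card_ord.
by rewrite -[leqLHS]card_ord; exact: leq_card S_inj.
Qed.

End ShiftGraph.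

(** * Cohomology *)

Section GModule.

Local Open Scope ring_scope.
Local Open Scope group_scope.

Variables (G : groupType) (M : gmodule G).

Implicit Types (c b : seq G -> M) (s : seq G).

Lemma gact0 g : gact g (0 : M) = 0.
Proof.
by apply: (@GRing.addrI _ (gact g (0 : M))); rewrite -gactD !GRing.addr0.
Qed.

Lemma gactN g (m : M) : gact g (- m) = - gact g m.
Proof.
by apply/eqP; rewrite -GRing.addr_eq0 -gactD GRing.addNr gact0.
Qed.

Lemma gactB g (m n : M) : gact g (m - n) = gact g m - gact g n.
Proof. by rewrite gactD gactN. Qed.

Definition lmul (g : G) s := [seq g * x | x <- s].

Lemma size_lmul g s : size (lmul g s) = size s.
Proof. exact: size_map. Qed.

Lemma lmul1 s : lmul 1 s = s.
Proof. by rewrite /lmul (eq_map (@mul1g G)) map_id. Qed.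

Lemma lmulM g h s : lmul (g * h) s = lmul g (lmul h s).
Proof. by rewrite /lmul -map_comp; apply: eq_map => x; rewrite /= mulgA. Qed.

Lemma lmulK g s : lmul g^-1 (lmul g s) = s.
Proof. by rewrite -lmulM mulVg lmul1. Qed.

(* The alternating sum of the faces of s, expanded along its first entry. *)
Fixpoint delta c s : M :=
  if s is y :: s' then c s' - delta (fun r => c (y :: r)) s' else 0.

Definition transl (g : G) c s : M := gact g (c (lmul g^-1 s)).

Lemma eq_delta n c c' s : (forall r, size r = n -> c r = c' r) ->
  size s = n.+1 -> delta c s = delta c' s.
Proof.
elim: s n c c' => [|y s ih] //= [|n] c c' cc' [sn]; rewrite cc' //.
  by case: s sn {ih}.
by congr (_ - _); apply: ih sn => r rn; apply: cc'; rewrite /= rn.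
Qed.

Lemma deltaB c c' s : delta (fun r => c r - c' r) s = delta c s - delta c' s.
Proof.
elim: s c c' => [|y s ih] c c' /=; first by rewrite GRing.subr0.
by rewrite ih !GRing.opprD GRing.addrACA.
Qed.

Lemma delta_transl g c s : delta (transl g c) s = transl g (delta c) s.
Proof.
rewrite /transl; elim: s c => [|y s ih] c /=; first by rewrite gact0.
by rewrite gactB -ih.
Qed.

Lemma delta_delta c s : delta (delta c) s = 0.
Proof.
elim: s c => [|y s ih] c //=.
by rewrite deltaB ih GRing.subr0 GRing.subrr.
Qed.

Lemma translM g h c s : transl (g * h) c s = transl g (transl h c) s.
Proof. by rewrite /transl gactM invgM lmulM. Qed.

Lemma transl1 c s : transl 1 c s = c s.
Proof. by rewrite /transl gact1 invg1 lmul1. Qed.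

End GModule.

(** * Vanishing of cohomology through HNN extensions *)

Section Vanishing.

Local Open Scope ring_scope.
Local Open Scope group_scope.

Variable Gamma : sgraph.

Local Notation G := (raag Gamma).

Lemma raag_ind_r (P : G -> Prop) :
  P 1 -> (forall v b g, P g -> P (g * letter v b)) -> forall g, P g.
Proof.
move=> P1 PM g; rewrite -[g]invgK; elim/raag_ind: g^-1 => [|v b h ih].
  by rewrite invg1.
by rewrite invgM -letterV; exact: PM.
Qed.

(** [phi] is a 1-form on the Cayley graph, closed on the commutation squares, hence exact: the
    action on pairs of an element and a running sum respects the relations. *)
Lemma raag_potential (N : zmodType) (phi : Gamma -> G -> N) :
  (forall v v' g, edge v v' ->
     phi v g + phi v' (g * gen v) = phi v' g + phi v (g * gen v')) ->
  exists W : G -> N,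
    W 1 = 0 /\ forall g v, W (g * gen v) = W g + phi v g.
Proof.
move=> phiC.
(* For a left action, g must move the element by g^-1 on the right, so the inverse letter is the one
   that steps forward. *)
pose f v (b : bool) (s : G * N) := if b then (s.1 * gen v, s.2 + phi v s.1)
  else (s.1 * (gen v)^-1, s.2 - phi v (s.1 * (gen v)^-1)).
pose I (s : G * N) := True.
have fI v b s : I s -> I (f v b s) by [].
have fK v b s : I s -> f v b (f v (~~ b) s) = s.
  case: s b => g n [] _.
    by rewrite /f /= mulgVK GRing.subrK.
  by rewrite /f /= mulgK GRing.addrK.
have fC v v' s : edge v v' -> I s ->
    f v false (f v' false s) = f v' false (f v false s).
  case: s => g n e _; rewrite /f /=.
  have gC : g * (gen v')^-1 * (gen v)^-1 = g * (gen v)^-1 * (gen v')^-1.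
    by rewrite -!mulgA -!invgM (gen_commute e).
  rewrite gC; congr pair; rewrite -!GRing.addrA -!GRing.opprD; congr (_ - _).
  set h := g * (gen v)^-1 * (gen v')^-1.
  have -> : g * (gen v')^-1 = h * gen v by rewrite /h -gC mulgVK.
  have -> : g * (gen v)^-1 = h * gen v' by rewrite /h mulgVK.
  by rewrite GRing.addrC phiC // GRing.addrC.
pose A := raag_act f.
have A1 h s : (A h s).1 = s.1 * h^-1.
  elim/raag_ind: h s => [|v b h ih] s.
    by rewrite /A (raag_act1 fI fK fC) // invg1 mulg1.
  rewrite /A (raag_actM fI fK fC) // (raag_act_letter fI fK fC) // -/A.
  rewrite invgM mulgA -ih -letterV.
  by case: b; rewrite /f //= -letterV.
exists (fun g => (A g^-1 (1, 0)).2); split=> [|g v].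
  by rewrite invg1 /A (raag_act1 fI fK fC).
rewrite invgM -(letterV v false) /A (raag_actM fI fK fC) //.
by rewrite (raag_act_letter fI fK fC) // -/A /f /= A1 invgK mul1g.
Qed.

Variable M : gmodule G.

(** Being fixed by [restrict P] expresses membership in the subgroup generated by [P]. *)
Definition equivariant_list (P : pred Gamma) n (c : seq G -> M) :=
  forall g s, restrict P g = g -> size s = n -> c (lmul g s) = gact g (c s).

(* H^n(A(P); M) = 0 for the subgroup A(P) generated by P, computed on the
   free A(P)-set G rather than on A(P) itself. *)
Definition vanishing (P : pred Gamma) n := forall c : seq G -> M,
  equivariant_list P n.+1 c ->
  (forall s, size s = n.+2 -> delta c s = 0) ->
  exists b, equivariant_list P n b /\
            forall s, size s = n.+1 -> c s = delta b s.

(** The subgroup is trivial, so equivariance is automatic and coning off at 1 is a contracting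
    homotopy. *)
Lemma vanishing_pred0 P n : P =1 pred0 -> vanishing P n.
Proof.
move=> P0 c _ dc; exists (fun s => c (1 :: s)); split=> [g s Pg _|s sn].
  have -> : g = 1.
    rewrite -Pg; elim/raag_ind: {Pg} g => [|v b h ih]; first exact: restrict1.
    by rewrite restrictM ih restrict_letter P0 mulg1.
  by rewrite lmul1 gact1.
by apply/eqP; rewrite -GRing.subr_eq0 -(dc (1 :: s)) //= sn.
Qed.

Lemma restrict_idem P (g : G) : restrict P (restrict P g) = restrict P g.
Proof. by rewrite restrict_comp; apply: eq_restrict => v; rewrite /= andbb. Qed.

Lemma restrict_sub (P Q : pred Gamma) (g : G) :
  subpred P Q -> restrict P g = g -> restrict Q g = g.
Proof.
move=> PQ Pg; rewrite -Pg restrict_comp; apply: eq_restrict => v /=.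
by case Pv: (P v); rewrite ?andbT ?andbF ?PQ.
Qed.

(** Hence [transl g c] depends only on the coset of [g], and translates can index vertices or edges
    of the Bass-Serre tree. *)
Lemma transl_equivariant P n c g h s :
  equivariant_list P n c -> restrict P h = h -> size s = n ->
  transl (g * h) c s = transl g c s.
Proof.
move=> cP Ph sn; rewrite translM /transl; congr gact.
have := cP h (lmul h^-1 (lmul g^-1 s)) Ph.
by rewrite !size_lmul -(lmulM h) mulgV lmul1 => /(_ sn) ->.
Qed.

(* A(u + P) is the HNN extension of A(P) over A(lk u), whose Bass-Serre tree
   has vertices A(u + P) / A(P) and edges A(u + P) / A(lk u). The families B
   and E of cochains are indexed by its vertices and edges; W sums E along
   paths from the base vertex, V along paths from the vertex of the first
   argument, and b = B - delta V does not depend on the vertex. *)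
Lemma vanishing_HNN (u : Gamma) (P : pred Gamma) n :
  vanishing P n.+2 -> vanishing (fun v => P v && edge u v) n.+1 ->
  vanishing (predU1 u P) n.+2.
Proof.
move=> vP vC c cQ dc; set Q := predU1 u P in cQ *.
set C := (fun v => P v && edge u v) in vC.
pose e : UMagmaMorphism.type G G := restrict Q.
have PQ : subpred P Q by move=> v Pv; rewrite /Q /= Pv orbT.
have CP : subpred C P by move=> v /andP[].
have e_id g : e (e g) = e g by exact: restrict_idem.
have e_u : e (gen u) = gen u.
  by rewrite [LHS]restrict_letter /Q /= eqxx.
have [|B1 [B1P cB]] := vP c _ dc.
  by move=> g s Pg; apply: cQ; exact: restrict_sub Pg.
pose B g := transl g B1.
pose D1 s := B (gen u) s - B1 s.
have commC g : commute (restrict C g) (gen u).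
  elim/raag_ind: g => [|v b g ih].
    by rewrite restrict1; exact/commute_sym/commute1.
  rewrite restrictM; apply/commute_sym/commuteM; last exact/commute_sym.
  rewrite restrict_letter /C.
  case: ifP => [/andP[_ uv]|_]; last exact: commute1.
  case: b; last exact: gen_commute.
  by rewrite (letterV _ false); apply/commuteV/gen_commute.
(* [D1] compares primitives of [c] at the two ends of the base edge: it is a cocycle, and
   equivariant under the link subgroup because that commutes with [u]. *)
have [||E1 [E1C DE]] := vC D1.
- move=> g s Cg sn; have Pg := restrict_sub CP Cg.
  have gu : (gen u)^-1 * g = g * (gen u)^-1.
    by apply/esym/commuteV; rewrite -Cg; exact: commC.
  rewrite /D1 /B /transl gactB -lmulM gu lmulM !(B1P g) ?size_lmul //.
  by rewrite -!gactM -Cg commC.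
- move=> s sn; rewrite /D1 deltaB delta_transl /transl -!cB ?size_lmul //.
  by rewrite -cQ ?size_lmul // -lmulM mulgV lmul1 GRing.subrr.
pose E g := transl g E1.
have BE g s : size s = n.+2 -> B (g * gen u) s - B g s = delta (E g) s.
  move=> sn; rewrite /E delta_transl /transl -DE ?size_lmul // /D1 gactB.
  by rewrite /B translM.
have EC g v s : size s = n.+1 -> edge u v -> E (e (g * gen v)) s = E (e g) s.
  move=> sn uv; rewrite gmulfM [e (gen v)]restrict_letter /Q /=.
  have [vu|_] := eqVneq v u; first by rewrite vu edge_irrefl in uv.
  case Pv: (P v) => /=; last by rewrite mulg1.
  by apply: (transl_equivariant _ E1C); rewrite // restrict_letter /C Pv uv.
(* [W s] steps by [E] along [u] only; squares close because a neighbour of [u] does not change [E].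
   Applying [e] first defines the form on the whole group. Lists of other lengths get 0. *)
have /choice[W WP] s : exists Ws : G -> M, size s = n.+1 -> Ws 1 = 0 /\
    forall g v, Ws (g * gen v) = Ws g + (if v == u then E (e g) s else 0).
  have [sn|/eqP sn] := eqVneq (size s) n.+1; last by exists (fun=> 0).
  have [|Ws WsP] :=
      @raag_potential M (fun v g => if v == u then E (e g) s else 0).
    move=> v v' g vv'.
    have [vu|nvu] := eqVneq v u; have [v'u|nv'u] := eqVneq v' u.
    - by rewrite vu v'u edge_irrefl in vv'.
    - by rewrite GRing.addr0 GRing.add0r EC // -vu.
    - by rewrite GRing.addr0 GRing.add0r EC // -v'u edge_sym.
    - by [].
  by exists Ws.
(* The base point is the first entry, which moves along with the list; this makes [V]
   equivariant. *)
pose V h s := transl (e (head 1 s)) (fun r => W r ((e (head 1 s))^-1 * h)) s.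
pose b h s := B h s - delta (V h) s.
have VE h s : e h = h -> size s = n.+1 -> V (h * gen u) s - V h s = E h s.
  move=> eh sn; rewrite /V /transl -gactB mulgA.
  set g := e _; have [_ ->] := WP (lmul g^-1 s) (etrans (size_lmul _ _) sn).
  rewrite eqxx GRing.addrAC GRing.subrr GRing.add0r gmulfM gmulfV e_id -/g eh.
  by rewrite -/(transl g _ s) /E -translM mulVKg.
(* Along [u] the change of [B] is the coboundary of [E], which [V] cancels; along any other [v]
   neither [B] nor [V] contributes a change. *)
have bM h v s : e h = h -> Q v -> size s = n.+2 -> b (h * gen v) s = b h s.
  move=> eh Qv sn; rewrite /b; have [->|vu] := eqVneq v u.
    have dV : delta (V (h * gen u)) s - delta (V h) s = delta (E h) s.
      by rewrite -deltaB; apply: (eq_delta _ sn) => r rn; exact: VE.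
    rewrite -[B _ s](GRing.subrK (B h s)) BE // -dV.
    rewrite GRing.addrAC [X in X + _]GRing.addrAC.
    by rewrite GRing.subrr GRing.add0r GRing.addrC.
  have Pv : P v by move: Qv; rewrite /Q /= (negPf vu).
  congr (_ - _).
    apply: (@transl_equivariant P _ B1 h (gen v) s B1P _ sn).
    by rewrite restrict_letter Pv.
  apply: (eq_delta _ sn) => r rn; rewrite /V /transl mulgA; congr gact.
  have [_ ->] := WP (lmul (e (head 1 r))^-1 r) (etrans (size_lmul _ _) rn).
  by rewrite (negPf vu) GRing.addr0.
have b_const g s : size s = n.+2 -> b (e g) s = b 1 s.
  move=> sn; elim/raag_ind_r: g => [|v ep g ih]; first by rewrite gmulf1.
  rewrite gmulfM [e (letter _ _)]restrict_letter.
  case: ifP => [Qv|_]; last by rewrite mulg1.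
  case: ep; last by rewrite -/(gen v) (bM _ _ _ (e_id g) Qv sn).
  rewrite -ih -[in RHS](mulgVK (gen v) (e g)) [letter v true](letterV v false).
  rewrite bM // gmulfM gmulfV e_id; congr (_ * _^-1).
  by rewrite [LHS]restrict_letter Qv.
have b_equiv g h s : e g = g -> size s = n.+2 ->
    b (g * h) (lmul g s) = gact g (b h s).
  move=> eg sn; rewrite /b gactB; congr (_ - _).
    by rewrite /B translM /transl lmulK.
  rewrite -[in RHS](lmulK g s) -/(transl g _ (lmul g s)) -delta_transl.
  apply: (@eq_delta _ _ n.+1); last by rewrite size_lmul sn.
  case=> [|y r] // _.
  have ey : e (g^-1 * y) = g^-1 * e y by rewrite gmulfM gmulfV eg.
  have -> : transl g (V h) (y :: r) = transl g (transl (g^-1 * e y)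
      (fun t => W t ((g^-1 * e y)^-1 * h))) (y :: r).
    by rewrite -ey.
  by rewrite -translM mulVKg invgM invgK -mulgA.
(* Moving the list by [g] moves the index from 1 to [g], on which [b] does not depend. *)
exists (b 1); split=> [g s Qg sn|s sn].
  by rewrite -(b_const g) ?size_lmul // [e g]Qg -b_equiv // mulg1.
rewrite /b deltaB delta_delta GRing.subr0 cB //.
by apply: (eq_delta _ sn) => r _; rewrite /B transl1.
Qed.

End Vanishing.

Section VanishingTriangleFree.

Variables (Gamma : sgraph) (M : gmodule (raag Gamma)).

Lemma mem_consE (x : Gamma) s :
  (fun v => v \in x :: s) = predU1 x (fun v => v \in s) :> pred Gamma.
Proof. by apply/funext => v; rewrite inE. Qed.

(** The added vertex has no neighbours in [s], so the edge group in [vanishing_HNN] is trivial. *)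
Lemma vanishing_independent (s : seq Gamma) n :
  {in s &, forall v w, ~~ edge v w} -> vanishing M (fun v => v \in s) n.+2.
Proof.
elim: s => [|x s ih] s_ind; first exact: vanishing_pred0.
rewrite mem_consE; apply: vanishing_HNN.
  by apply: ih => v w vs ws; apply: s_ind; rewrite inE ?vs ?ws orbT.
apply: vanishing_pred0 => v /=; apply/negP => /andP[vs].
by apply/negP/s_ind; rewrite inE ?eqxx ?vs ?orbT.
Qed.

(** Without triangles the neighbours of [x] are pairwise non-adjacent: the edge group is free, with
    vanishing from degree 2 on, which [vanishing_HNN] raises to degree 3. *)
Lemma vanishing_triangle_free (s : seq Gamma) n :
  (forall u v w : Gamma, edge u v -> edge v w -> edge u w -> False) ->
  vanishing M (fun v => v \in s) n.+3.
Proof.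
move=> tf; elim: s => [|x s ih]; first exact: vanishing_pred0.
rewrite mem_consE; apply: vanishing_HNN => //.
have -> : (fun v => (v \in s) && edge x v) = (fun v => v \in filter (edge x) s).
  by apply/funext => v; rewrite mem_filter andbC.
apply: vanishing_independent => v w.
rewrite !mem_filter => /andP[xv _] /andP[xw _].
by apply/negP => vw; exact: (tf x v w).
Qed.

End VanishingTriangleFree.

(** * Cochains on lists and on functions from ordinals *)

Section ListCochains.

Local Open Scope ring_scope.

Variables (G : groupType) (M : gmodule G).

Definition ffun_list n (x : {ffun 'I_n.+1 -> G}) : seq G :=
  mkseq (fun k => x (inord k)) n.+1.

Definition list_ffun n (s : seq G) : {ffun 'I_n.+1 -> G} :=
  [ffun i : 'I_n.+1 => nth 1%g s i].

Definition omit i (s : seq G) := take i s ++ drop i.+1 s.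

Lemma size_ffun_list n (x : {ffun 'I_n.+1 -> G}) : size (ffun_list x) = n.+1.
Proof. exact: size_mkseq. Qed.

Lemma ffun_listK n : cancel (@ffun_list n) (@list_ffun n).
Proof.
move=> x; apply/ffunP => i; rewrite ffunE nth_mkseq //.
by rewrite inord_val.
Qed.

Lemma list_ffunK n s : size s = n.+1 -> ffun_list (list_ffun n s) = s.
Proof.
move=> sn; apply: (@eq_from_nth _ 1%g); rewrite size_ffun_list ?sn // => i ilt.
by rewrite nth_mkseq // ffunE inordK.
Qed.

Lemma ffun_list_lmul n g (x : {ffun 'I_n.+1 -> G}) :
  ffun_list [ffun i => g * x i]%g = lmul g (ffun_list x).
Proof.
rewrite /lmul /ffun_list /mkseq -map_comp; apply: eq_map => k.
by rewrite /= ffunE.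
Qed.

Lemma omit_ffun_list n (x : {ffun 'I_n.+2 -> G}) (i : 'I_n.+2) :
  omit i (ffun_list x) = ffun_list [ffun j => x (lift i j)].
Proof.
have io : size (omit i (ffun_list x)) = n.+1.
  rewrite size_cat size_take size_drop size_ffun_list ltn_ord.
  by case: i => /=; lia.
apply: (@eq_from_nth _ 1%g); rewrite io ?size_ffun_list // => k kn.
rewrite nth_mkseq // ffunE /omit nth_cat size_take size_ffun_list ltn_ord.
case: ltnP => ki.
  rewrite nth_take // nth_mkseq; last by lia.
  by congr (x _); apply: val_inj; rewrite /= !inordK /bump; lia.
rewrite nth_drop nth_mkseq; last by lia.
by congr (x _); apply: val_inj; rewrite /= !inordK /bump; lia.
Qed.

Lemma delta_sum (c : seq G -> M) s :
  delta c s = \sum_(i < size s) c (omit i s) *~ (-1) ^+ i.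
Proof.
elim: s c => [|y s ih] c /=; first by rewrite big_ord0.
rewrite big_ord_recl /= GRing.expr0 mulr1z /omit /= drop0; congr (_ + _).
rewrite ih -GRing.sumrN; apply: eq_bigr => i _.
by rewrite /bump /= GRing.exprS GRing.mulN1r mulrNz.
Qed.

Lemma coboundary_delta n (c : seq G -> M) (x : {ffun 'I_n.+2 -> G}) :
  coboundary_map (fun y : {ffun 'I_n.+1 -> G} => c (ffun_list y)) x
  = delta c (ffun_list x).
Proof.
rewrite delta_sum size_ffun_list; apply: eq_bigr => i _.
by rewrite omit_ffun_list.
Qed.

End ListCochains.

(** * Cohomological dimension two *)

Section Dimension.

Local Open Scope ring_scope.

Variable Gamma : sgraph.

Local Notation G := (raag Gamma).

Lemma vanishing_cohomology_trivial (M : gmodule G) (P : pred Gamma) n :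
  (forall v, P v) -> vanishing M P n.+1 -> cohomology_trivial M n.+1.
Proof.
move=> PT vM c [c_eq c_coc]; pose c' s := c (list_ffun n.+1 s).
have cE x : c x = c' (ffun_list x) by rewrite /c' ffun_listK.
have [g s _ sn|s sn|b [b_eq c'E]] := vM c'.
- rewrite /c' -c_eq; congr c; apply/ffunP => i; rewrite !ffunE.
  by rewrite (nth_map 1%g) // sn.
- rewrite -(list_ffunK sn) -coboundary_delta -[RHS](c_coc (list_ffun n.+2 s)).
  by apply: eq_bigr => i _; rewrite -cE.
exists (fun x => b (ffun_list x)); split=> [g x|x].
  by rewrite ffun_list_lmul b_eq ?restrict_id ?size_ffun_list.
by rewrite coboundary_delta cE c'E ?size_ffun_list.
Qed.

Lemma exponent_sum (v0 : Gamma) : exists alpha : G -> int,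
  (forall g h, alpha (g * h)%g = alpha g + alpha h) /\
  forall v, alpha (gen v) = (v == v0)%:R.
Proof.
have [|W [W1 WM]] := @raag_potential Gamma int (fun v _ => (v == v0)%:R).
  by move=> v v' _ _; exact: GRing.addrC.
have Wgen v : W (gen v) = (v == v0)%:R.
  by rewrite -[gen v]mul1g WM W1 GRing.add0r.
exists W; split=> // g h; elim/raag_ind_r: h => [|v b h ih].
  by rewrite mulg1 W1 GRing.addr0.
case: b; last by rewrite -/(gen v) mulgA !WM ih GRing.addrA.
have WV x : W (x * letter v true)%g = W x - (v == v0)%:R.
  rewrite -[in RHS](mulgVK (gen v) x) WM GRing.addrK.
  by rewrite [letter v true](letterV v false).
by rewrite mulgA !WV ih GRing.addrA.
Qed.

Definition trivial_gmodule : gmodule G :=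
  @GModule G int (fun _ m => m) (fun _ => erefl) (fun _ _ _ => erefl)
    (fun _ _ _ => erefl).

(* The cup product of the exponent sums of v and w is 1 on the torus
   [1, v, v w] - [1, w, w v]. *)
Lemma edge_cohomology_nontrivial (v w : Gamma) :
  edge v w -> ~ cohomology_trivial trivial_gmodule 2.
Proof.
move=> vw triv.
have [alpha [alphaM alphaE]] := exponent_sum v.
have [beta [betaM betaE]] := exponent_sum w.
have alpha1 : alpha 1%g = 0.
  by apply: (@GRing.addrI _ (alpha 1%g)); rewrite -alphaM mul1g GRing.addr0.
pose c (s : seq G) : trivial_gmodule :=
  (alpha (nth 1%g s 1) - alpha (nth 1%g s 0))
  * (beta (nth 1%g s 2) - beta (nth 1%g s 1)) : int.
have [|b [b_eq cb]] := triv (fun x => c (ffun_list x)).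
  split=> [g x|x].
    rewrite ffun_list_lmul /c !(nth_map 1%g) ?size_ffun_list //= !alphaM !betaM.
    by ring.
  by rewrite coboundary_delta /ffun_list /c /=; ring.
pose b' s := b (list_ffun 1 s).
have cE s : size s = 3 -> c s = delta b' s.
  move=> sn; rewrite -(list_ffunK sn) cb -coboundary_delta.
  by apply: eq_bigr => i _; rewrite /b' ffun_listK.
have b'_eq g h k : b' [:: (g * h)%g; (g * k)%g] = b' [:: h; k].
  rewrite /b' -[RHS]/(@gact _ trivial_gmodule g _) -b_eq; congr b.
  apply/ffunP => i; rewrite !ffunE.
  by case: i => [[|[|]]].
(* By invariance both sides are b'[1, v] + b'[1, w] - b'[1, v w], as [v] and [w] commute; yet the
   values of [c] are 1 and 0. *)
have torus :
    c [:: 1; gen v; gen v * gen w]%g = c [:: 1; gen w; gen w * gen v]%g.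
  have b'1 g h : b' [:: g; (g * h)%g] = b' [:: 1%g; h].
    by rewrite -[X in [:: X; _]]mulg1 b'_eq.
  rewrite !cE //= !b'1 (gen_commute vw) !GRing.opprB !GRing.subr0; ring.
have nvw : w != v by apply: contraTneq vw => ->; rewrite edge_irrefl.
move: torus; rewrite /c /= !betaM alpha1 !alphaE !betaE !eqxx.
by rewrite (negPf nvw) eq_sym (negPf nvw).
Qed.

Lemma triangle_free_has_cd2 (s : seq Gamma) (v w : Gamma) :
  (forall x, x \in s) ->
  (forall x y z : Gamma, edge x y -> edge y z -> edge x z -> False) ->
  edge v w -> has_cd G 2.
Proof.
move=> sT tf vw; split=> [|[|[|[|m]]] // _ M].
  by exists trivial_gmodule; exact: edge_cohomology_nontrivial vw.
apply: (@vanishing_cohomology_trivial M (fun x => x \in s)) => //.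
exact: vanishing_triangle_free.
Qed.

Lemma raag_finitely_generated (s : seq Gamma) :
  (forall x, x \in s) -> finitely_generated G.
Proof.
move=> sT; exists (map (@gen Gamma) s) => S S_closed sS.
elim/raag_ind => [|v b g gS]; first by case: S_closed.
have vS : gen v \in S by apply/sS/map_f.
apply: group_closedM => //; case: b => //.
by rewrite (letterV v false); exact: group_closedV.
Qed.

End Dimension.

(** * Shift graphs against the chromatic bound *)

Theorem theorem14 : ~ (exists G : groupType, universal_raag 2 G).
Proof.
move=> [G [[G_fg [Gamma [f f_bij]] _] G_univ]].
have [U UP] := finitely_generated_support f_bij G_fg.
case: (f_bij) => f' fK f'K; have f'M := can2_gmulfM fK f'K.
(* This [n] exceeds the bound [2 ^ k] of [shift_colouring], and is at least 3, so that 0 < 1 < 2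
   yields an edge. *)
pose k := size U; pose n := (2 ^ k).+3; pose Lambda := doubled_shift_graph n.
pose V := ('I_n * 'I_n)%type.
have Lambda_enum (x : Lambda) : x \in enum {: 'I_n * 'I_n * bool}.
  by rewrite mem_enum.
have Lambda_fg : fg_raag_of_dim 2 (raag Lambda).
  split.
  - exact: raag_finitely_generated Lambda_enum.
  - by exists Lambda, idfun; exists idfun.
  - pose v : Lambda := (inord 0, inord 1, false).
    pose w : Lambda := (inord 1, inord 2, false).
    apply: (@triangle_free_has_cd2 _ _ v w Lambda_enum).
      exact: shift_triangle_free.
    by rewrite /= /shift_edge /shift_arc /= eqxx !inordK.
have [phi phi_inj] := G_univ _ Lambda_fg.
pose a b (p : V) := f' (phi (gen ((p, b) : Lambda))).
have aM b b' p q : edge ((p, b) : Lambda) ((q, b') : Lambda) ->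
    commute (a b p) (a b' q).
  by move=> e; rewrite /commute /a -!f'M -!gmulfM gen_commute.
have [||c [c_lt c_neq]] := @commuting_pairs_colouring _ U V
  (fun p q => edge ((p, false) : Lambda) ((q, false) : Lambda))
  (a false) (a true) _ _.
- by move=> p q e; split; exact: aM.
- by move=> p; exact: UP.
have a_neq p : [~ a false p, a true p]%g != 1%g.
  apply/commgP => ap; apply: (@gen_not_commute Lambda (p, false) (p, true)).
  - by rewrite xpair_eqE andbF.
  - exact/negbT/(@edge_irrefl Lambda (p, false)).
  apply: phi_inj; apply: (can_inj f'K); rewrite !gmulfM !f'M; exact: ap.
suff : n <= 2 ^ k by rewrite /n; lia.
apply: (@shift_colouring n k c) => [i j ij|i j l ij jl]; first exact: c_lt.
by apply: c_neq => //; rewrite /= /shift_edge /shift_arc /= eqxx ij jl.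
Qed.
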